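(* Consider the enlarged dual problem $$(\tilde D)\quad 0\in\partial(\mathbf{f}^*+\iota_\Delta^* )(\mathbf{y})+\tfrac12\mathbf{y}+T\mathbf{y}$$ and the dual problem $$(D)\quad 0\in(\partial\mathbf{f})^{-1}(\mathbf{y})+(\operatorname{Id}-\mathbf{R})^{-1}\mathbf{y},$$ both in the unknown $\mathbf{y}\in\mathbf{X}$. Then: (i) $(\tilde D)$ always has a unique solution. (ii) If $(D)$ has a solution, then it is exactly the solution of $(\tilde D)$.
   Context: $X$ is a real Hilbert space, $m\in\{1,2,\dots\}$, $\mathbf{X}=X^m$ is the product Hilbert space, $\mathbf{R}(x_1,\dots,x_m)=(x_m,x_1,\dots,x_{m-1})$, $\Delta=\{(x,\dots,x):x\in X\}$ with orthogonal complement $\Delta^\perp$, $(\operatorname{Id}-\mathbf{R})^{-1}$ is the set-valued inverse, and $T=\frac{1}{2m}\sum_{k=1}^{m-1}(m-2k)\mathbf{R}^k$. $f_1,\dots,f_m$ are proper lower semicontinuous convex functions $X\to\,]-\infty,+\infty]$, $\mathbf{f}(x_1,\dots,x_m)=\sum_{i=1}^m f_i(x_i)$, $\mathbf{f}^*$ is the Fenchel conjugate, $\iota_\Delta^*=\iota_{\Delta^\perp}$ is the conjugate of the indicator function of $\Delta$, and $\partial$ is the convex subdifferential. Standing assumption: $\operatorname{dom}\mathbf{f}^*\cap\Delta^\perp\neq\varnothing$. *)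

(* Defs.v *)
From HB Require Import structures.
From mathcomp Require Import all_boot all_order all_algebra.
From mathcomp Require Import all_classical all_reals all_analysis.

Set Implicit Arguments.
Unset Strict Implicit.
Unset Printing Implicit Defensive.

Import Order.TTheory GRing.Theory Num.Theory.
Import numFieldNormedType.Exports.

Local Open Scope classical_set_scope.
Local Open Scope ring_scope.

(* A real Hilbert space is a complete normed module X with an inner product
   [dot : {dot X for idfun}] (symmetric, bilinear, positive definite) that
   induces the norm of X. *)
Definition induces_norm (R : realType) (X : completeNormedModType R)
    (dot : {dot X for idfun}) : Prop :=
  forall x : X, dot x x = `|x| ^+ 2.

(* X^m is the module 'I_m -> X of m-tuples, with this inner product. *)
Definition prod_dot (R : realType) (X : lmodType R) (m : nat)
    (dot : X -> X -> R) (x y : 'I_m -> X) : R :=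
  \sum_(i < m) dot (x i) (y i).

Section set_valued.
Context {V : zmodType}.
Implicit Types (A B : V -> set V) (C D : set V).

Definition addset C D : set V := [set c + d | c in C & d in D].

Definition inv_op A : V -> set V := fun y => [set x | A x y].

Definition graph_op (F : V -> V) : V -> set V := fun x => [set F x].

End set_valued.

Section convex_analysis.
Context {R : realType} {V : lmodType R}.
Variable dot : V -> V -> R.
Implicit Types (f : V -> \bar R) (C : set V).
Local Open Scope ereal_scope.

Definition edom f : set V := [set x | f x < +oo].

Definition ereal_proper f : Prop := (forall x, f x != -oo) /\ edom f !=set0.

(* Only used for functions that avoid -oo. *)
Definition ereal_convex f : Prop :=
  forall (x y : V) (t : R), (0 < t < 1)%R ->
    f (t *: x + (1 - t) *: y)%R <= t%:E * f x + (1 - t)%:E * f y.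

Definition cvx_indicator C : V -> \bar R := fun x => if x \in C then 0 else +oo.

Definition fenchel_conj f : V -> \bar R :=
  fun u => ereal_sup [set (dot x u)%:E - f x | x in [set: V]].

Definition subdiff f : V -> set V :=
  fun x => [set u | forall y, (dot (y - x)%R u)%:E + f x <= f y].

Definition orth_compl C : set V :=
  [set u | forall x, C x -> dot x u = 0%R].

End convex_analysis.

Section product_space.
Context {R : realType} {X : lmodType R} {m : nat}.
Implicit Types x y : 'I_m -> X.

Definition diagonal_space : set ('I_m -> X) :=
  [set x | exists z : X, x = fun=> z].

(* [ord_pred] is the cyclic predecessor:
   (x_0, ..., x_(m-1)) is sent to (x_(m-1), x_0, ..., x_(m-2)). *)
Definition cyclic_shift x : 'I_m -> X := fun i => x (ord_pred i).

Definition skewT x : 'I_m -> X :=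
  (2 * m%:R)^-1 *:
    \sum_(1 <= k < m) (m%:R - 2 * k%:R : R) *: iter k cyclic_shift x.

Definition sep_sum (f : 'I_m -> X -> \bar R) : ('I_m -> X) -> \bar R :=
  fun x => (\sum_(i < m) f i (x i))%E.

End product_space.

Section dual_problems.
Context {R : realType} {X : lmodType R} {m : nat}.
Variables (dot : X -> X -> R) (f : 'I_m -> X -> \bar R).

Let pdot := @prod_dot R X m dot.

Definition enlarged_dual_solutions : set ('I_m -> X) :=
  [set y | addset
             (addset
                (subdiff pdot
                   (fun z => fenchel_conj pdot (sep_sum f) z +
                             fenchel_conj pdot (cvx_indicator diagonal_space) z)%E y)
                [set 2^-1 *: y])
             [set skewT y] 0].

Definition dual_solutions : set ('I_m -> X) :=
  [set y | addset (inv_op (subdiff pdot (sep_sum f)) y)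
                  (inv_op (graph_op (fun x => x - cyclic_shift x)) y) 0].

End dual_problems.

(* Main.v *)
Require Import Defs.
From HB Require Import structures.
From mathcomp Require Import all_boot all_order all_algebra.
From mathcomp Require Import all_classical all_reals all_analysis.
From mathcomp Require Import ring lra.

Set Implicit Arguments.
Unset Strict Implicit.
Unset Printing Implicit Defensive.

Import Order.TTheory GRing.Theory Num.Theory.
Import numFieldNormedType.Exports.

Local Open Scope classical_set_scope.
Local Open Scope ring_scope.

(** Write [F] for the function [f^* + iota_Delta^*] and [B y = y / 2 + T y],
    so that the enlarged dual problem reads [- B y \in dF(y)].

    Part (i).  The operator [T] is skew: in [<T x, x>] the terms of index [k]
    and [m - k] cancel, because the shift is an isometry of period [m].  Hence
    [B] is linear, bounded and strongly monotone with constant [1/2], and the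
    claim is an instance of [strongly_monotone_inclusion].  That theorem is
    proved by Banach iteration: for small [g > 0] the map
    [y |-> prox_(gF) (y - g B y)] is a contraction, since the proximal map is
    nonexpansive and [Id - g B] contracts; its fixed points are exactly the
    solutions.  The proximal map exists ([prox_exists]) because [F] is a
    supremum of continuous affine functions ([conj_support_affine_sup]): this
    makes [F] convex and closed and bounds it below by an affine function, so
    every minimizing sequence of [F + |. - z|^2 / (2 g)] is Cauchy by the
    parallelogram identity.

    Part (ii).  A solution [y] of the dual problem comes with [x] and [w] such
    that [y \in df(x)], [y = w - R w] and [x + w = 0].  Summation by parts
    gives [B (w - R w) = w - m^-1 \sum_(k < m) R^k w]
    ([skewT_subr_shift]), and the average on the right lies in [Delta]; thus
    [- B y = x + d] with [d \in Delta].  As [y] is orthogonal to [Delta],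
    Fenchel-Young equality gives [x + d \in dF(y)]
    ([subdiff_conj_support]).  So dual solutions solve the enlarged problem,
    and uniqueness in (i) upgrades this inclusion to an equality as soon as a
    dual solution exists.

    Distances are measured by [dot (x - y) (x - y)] throughout: squared
    distances suffice for all convergence arguments and avoid putting a second
    normed structure on the product space. *)

(** * Inner products and the convergence they define *)

Section inner_product.
Context {R : realType} {V : lmodType R} (dot : {dot V for idfun}).
Implicit Types (u v w x y z : V) (a t : R).

Lemma dotC u v : dot u v = dot v u.
Proof. by rewrite (hermC dot u v) expr0 mul1r. Qed.

Lemma dotDl u v w : dot (u + v) w = dot u w + dot v w.
Proof. exact: linearDl. Qed.

Lemma dotDr u v w : dot w (u + v) = dot w u + dot w v.
Proof. exact: linearDr. Qed.

Lemma dotNl u w : dot (- u) w = - dot u w.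
Proof. exact: linearNl. Qed.

Lemma dotNr u w : dot w (- u) = - dot w u.
Proof. exact: linearNr. Qed.

Lemma dotZl a u w : dot (a *: u) w = a * dot u w.
Proof. exact: linearZl_LR. Qed.

Lemma dotZr a u w : dot w (a *: u) = a * dot w u.
Proof. exact: linearZr_LR. Qed.

Lemma dot0l w : dot 0 w = 0.
Proof. exact: linear0l. Qed.

Definition dotE := (dotDl, dotDr, dotNl, dotNr, dotZl, dotZr).

Lemma dot_ge0 u : 0 <= dot u u.
Proof.
have [->|u0] := eqVneq u 0; first by rewrite dot0l.
exact/ltW/neq0_dnorm_gt0.
Qed.

Lemma dot_eq0 u : dot u u = 0 -> u = 0.
Proof.
have [->//|u0] := eqVneq u 0.
by have := @neq0_dnorm_gt0 _ _ _ dot _ u0 => /[swap] ->; rewrite ltxx.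
Qed.

Lemma dot_sqrD_le u v : dot (u + v) (u + v) <= 2 * dot u u + 2 * dot v v.
Proof.
have := dot_ge0 (u - v); rewrite !dotE (dotC v u); lra.
Qed.

Lemma cauchy_schwarz u v : dot u v ^+ 2 <= dot u u * dot v v.
Proof.
have [->|v0] := eqVneq v 0.
  by rewrite dotC !dot0l expr2 mul0r mulr0.
have vv : 0 < dot v v by exact: neq0_dnorm_gt0.
have := dot_ge0 (dot v v *: u - dot u v *: v).
rewrite !dotE (dotC v u).
(* The square of the residual of projecting [u] on [v], scaled by [dot v v]. *)
set p := dot v v in vv *; set q := dot u v; set r := dot u u.
rewrite [X in 0 <= X](_ : _ = p * (r * p - q ^+ 2)); last by ring.
by rewrite pmulr_rge0// subr_ge0.
Qed.

Definition dot_cvg (u : V ^nat) (l : V) :=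
  dot (u n - l) (u n - l) @[n --> \oo] --> (0 : R).

(** The Cauchy condition is given with a rate [e], because the sequences built
    below come with one; every Cauchy sequence has a subsequence of this form,
    so this is the usual completeness. *)
Definition dot_complete := forall (u : V ^nat) (e : R ^nat),
  e @ \oo --> (0 : R) ->
  (forall n k, dot (u n - u k) (u n - u k) <= e n + e k) ->
  exists l, dot_cvg u l.

Lemma dot_cvg_weak (s : V ^nat) l w : dot_cvg s l ->
  dot w (s n - l) @[n --> \oo] --> (0 : R).
Proof.
move=> sl; apply/norm_cvg0P.
have s0 :
    Num.sqrt (dot w w * dot (s n - l) (s n - l)) @[n --> \oo] --> (0 : R).
  rewrite -(@sqrtr0 R); apply: (continuous_cvg _ (@sqrt_continuous R 0)).
  by rewrite -(mulr0 (dot w w)); apply: cvgMr.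
apply: (squeeze_cvgr _ (cvg_cst 0) s0); near=> n.
by rewrite normr_ge0/= -sqrtr_sqr ler_wsqrtr// cauchy_schwarz.
Unshelve. all: by end_near. Qed.

End inner_product.

(** * Suprema of affine functions and their proximal maps *)

(** Extracts a first-order optimality condition from the second-order
    expansion along a segment. *)
Lemma affine_ge0_at0 (R : realType) (a b : R) :
  (forall t, 0 < t < 1 -> 0 <= a + t * b) -> 0 <= a.
Proof.
move=> ab; rewrite leNgt; apply/negP => a0.
have b0 : 0 <= `|b| by [].
have bb : b <= `|b| by exact: ler_norm.
have s0 : 0 < 2 * (`|b| - a) by lra.
have t0 : 0 < - a / (2 * (`|b| - a)) by apply: divr_gt0; lra.
have t1 : - a / (2 * (`|b| - a)) < 1 by rewrite ltr_pdivrMr//; lra.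
(* At half the zero of [a + t (|b| - a)] the affine function is negative. *)
have := ab (- a / (2 * (`|b| - a))); rewrite t0 t1 => /(_ isT).
suff : - a / (2 * (`|b| - a)) * b <= - a / 2 by lra.
rewrite mulrAC ler_pdivrMr//; nra.
Qed.

Section supremum_of_affine.
Context {R : realType} {V : lmodType R} (dot : {dot V for idfun}).
Implicit Types (F : V -> \bar R) (A : set (V * R)) (u v w x y z : V).
Implicit Types (a b c d t : R).

(** [F] is the pointwise supremum of the functions [y |-> <p.1, y> - p.2] for
    [p \in A].  Describing [F] through its real upper bounds keeps extended
    reals out of the estimates; on a Hilbert space, nonempty families [A]
    represent the closed convex functions avoiding [-oo]. *)
Definition affine_sup A F := forall y c,
  (F y <= c%:E)%E <-> forall p, A p -> dot p.1 y - p.2 <= c.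

Context {F : V -> \bar R} {A : set (V * R)}.
Hypotheses (FA : affine_sup A F) (A0 : A !=set0).

Lemma affine_sup_gtNy y : F y != -oo%E.
Proof.
case: A0 => p Ap; apply/eqP => Fy.
have : (F y <= (dot p.1 y - p.2 - 1)%:E)%E by rewrite Fy leNye.
by move/FA => /(_ p Ap); lra.
Qed.

Lemma affine_sup_fin y : edom F y -> exists c, F y = c%:E.
Proof.
rewrite /edom/=; have := affine_sup_gtNy y.
by case: (F y) => // c _ _; exists c.
Qed.

Lemma affine_sup_convex y z c d t : (F y <= c%:E)%E -> (F z <= d%:E)%E ->
  0 <= t <= 1 -> (F (t *: y + (1 - t) *: z)%R <= (t * c + (1 - t) * d)%:E)%E.
Proof.
move=> /FA Fy /FA Fz /andP[t0 t1]; apply/FA => p Ap.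
have := Fy p Ap; have := Fz p Ap; rewrite !dotE; nra.
Qed.

Lemma subdiff_epiP x c u : F x = c%:E ->
  subdiff dot F x u <-> forall y d, (F y <= d%:E)%E -> dot (y - x) u + c <= d.
Proof.
move=> Fx; rewrite /subdiff/= Fx; split=> [xu y d Fyd|xu y].
  by rewrite -lee_fin EFinD (le_trans (xu y)).
have := affine_sup_gtNy y; have := xu y.
case: (F y) => [d|_|] //; last by rewrite leey.
by move=> /(_ d (lexx _)) xd _; rewrite -EFinD lee_fin.
Qed.

Lemma subdiff_edom x u : edom F !=set0 -> subdiff dot F x u -> edom F x.
Proof.
case=> y Fy /(_ y) xy; rewrite /edom/= ltey; apply/eqP => Fx.
by move: xy; rewrite Fx addey// leNgt Fy.
Qed.

Lemma subdiff_monotone x y u v : edom F !=set0 ->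
  subdiff dot F x u -> subdiff dot F y v -> 0 <= dot (u - v) (x - y).
Proof.
move=> F0 xu yv.
have [c Fx] := affine_sup_fin (subdiff_edom F0 xu).
have [d Fy] := affine_sup_fin (subdiff_edom F0 yv).
move/(subdiff_epiP _ Fx) : xu => /(_ y d); rewrite Fy => /(_ (lexx _)).
move/(subdiff_epiP _ Fy) : yv => /(_ x c); rewrite Fx => /(_ (lexx _)).
rewrite !dotE (dotC _ x u) (dotC _ y u) (dotC _ x v) (dotC _ y v); lra.
Qed.

Hypothesis Vc : dot_complete dot.

(** The minimizer [p] of [F y + |y - z|^2 / (2 g)], characterized by its
    optimality condition.  The objective is bounded below thanks to an affine
    minorant of [F], it is uniformly convex so minimizing sequences converge,
    and the limit is a minimizer because [F] is closed. *)
Lemma prox_exists z g : edom F !=set0 -> 0 < g ->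
  exists p, subdiff dot F p (g^-1 *: (z - p)).
Proof.
move=> F0 g0; pose h := (2 * g)^-1.
have h0 : 0 < h by rewrite invr_gt0; lra.
have hg : g * h = 2^-1 by rewrite /h invfM mulrCA divff ?mulr1// gt_eqF.
have hgV : g^-1 = 2 * h by rewrite /h invfM mulrA divff ?mul1r.
pose G y d := d + h * dot (y - z) (y - z).
pose S := [set r | exists y d, (F y <= d%:E)%E /\ r = G y d].
have Sinf : has_inf S.
  split.
    case: F0 => y /affine_sup_fin[c Fy].
    by exists (G y c), y, c; rewrite Fy.
  case: A0 => p Ap; exists (dot p.1 z - p.2 - g / 2 * dot p.1 p.1).
  move=> _ [y [d [/FA /(_ p Ap) yd ->]]]; rewrite /G.
  (* Completing the square: the affine minorant attached to [p] plus the
     quadratic term is smallest at [y = z - g p.1]. *)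
  have := mulr_ge0 (ltW h0) (dot_ge0 dot (y - z + g *: p.1)).
  have -> : dot (y - z + g *: p.1) (y - z + g *: p.1) =
      dot (y - z) (y - z) + 2 * g * (dot p.1 y - dot p.1 z) +
        g * g * dot p.1 p.1.
    by rewrite !dotE (dotC _ y p.1) (dotC _ z p.1); ring.
  have -> : h * (dot (y - z) (y - z) + 2 * g * (dot p.1 y - dot p.1 z) +
        g * g * dot p.1 p.1) = h * dot (y - z) (y - z) +
        2 * (g * h) * (dot p.1 y - dot p.1 z) + g * (g * h) * dot p.1 p.1.
    by ring.
  rewrite hg; lra.
pose m := inf S.
have mG y d : (F y <= d%:E)%E -> m <= G y d.
  by move=> Fyd; apply: ge_inf; [exact: Sinf.2|exists y, d].
have /choice[u uP] : forall n, exists p : V * R,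
    (F p.1 <= p.2%:E)%E /\ G p.1 p.2 <= m + harmonic n.
  move=> n.
  have [|_ [y [d [Fyd ->]]] yd] := @inf_adherent _ S (harmonic n) _ Sinf.
    by rewrite /harmonic/= invr_gt0.
  by exists (y, d); split => //; exact: ltW.
have [l ul] : exists l, dot_cvg dot (fun n => (u n).1) l.
  apply: (Vc (e := fun n => (2 / h) * harmonic n)).
    by rewrite -(mulr0 (2 / h)); apply: cvgMr; exact: cvg_harmonic.
  move=> n k; have [Fn Gn] := uP n; have [Fk Gk] := uP k.
  have half : 0 <= (2^-1 : R) <= 1 by apply/andP; split; lra.
  (* Compare the infimum with the value at the midpoint. *)
  have := mG _ _ (affine_sup_convex Fn Fk half).
  move: Gn Gk; rewrite /G; set y := (u n).1; set y' := (u k).1.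
  set d := (u n).2; set d' := (u k).2.
  have -> : dot (2^-1 *: y + (1 - 2^-1) *: y' - z)
      (2^-1 *: y + (1 - 2^-1) *: y' - z) = 2^-1 * dot (y - z) (y - z) +
      2^-1 * dot (y' - z) (y' - z) - 4^-1 * dot (y - y') (y - y').
    by rewrite !dotE (dotC _ y' y) (dotC _ z y) (dotC _ z y'); field.
  move=> Gn Gk mid.
  rewrite [leRHS](_ : _ = 2 * (harmonic n + harmonic k) / h); last by ring.
  rewrite ler_pdivlMr//; move: Gn Gk mid.
  move: (harmonic n) (harmonic k) => en ek.
  by move: (dot _ _) (dot (y' - z) _) (dot (y - y') _) => ? ? ?; lra.
have Fl : (F l <= (m - h * dot (l - z) (l - z))%:E)%E.
  (* [w] is the gradient at [l] of the affine function of [p] plus the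
     quadratic term; the remainder of the expansion at [l] is nonnegative. *)
  apply/FA => p Ap; pose w := p.1 + (2 * h) *: (l - z).
  have : (m + harmonic n - dot w ((u n).1 - l)) @[n --> \oo] --> m + 0 - 0.
    apply: cvgB; last exact: dot_cvg_weak.
    by apply: cvgD; [exact: cvg_cst|exact: cvg_harmonic].
  rewrite addr0 subr0 => lim_m.
  rewrite lerBrDr; apply: (cvgr_to_ge lim_m).
  near=> n; have [/FA /(_ p Ap) Fn] := uP n; rewrite /G /w.
  have := mulr_ge0 (ltW h0) (dot_ge0 dot ((u n).1 - l)).
  rewrite !dotE (dotC _ l (u n).1) (dotC _ z (u n).1) (dotC _ z l); nra.
have [c lc] : exists c, F l = c%:E.
  by apply: affine_sup_fin; exact: le_lt_trans Fl (ltry _).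
have cm : c = m - h * dot (l - z) (l - z).
  apply/eqP; rewrite eq_le -lee_fin -lc Fl/= lerBlDr.
  by apply: mG; rewrite lc.
exists l; apply/(subdiff_epiP _ lc) => y d Fyd.
rewrite -subr_ge0.
apply: (affine_ge0_at0 (b := h * dot (y - l) (y - l))) => t /andP[t0 t1].
have t01 : 0 <= t <= 1 by rewrite !ltW.
have lcc : (F l <= c%:E)%E by rewrite lc.
have := mG _ _ (affine_sup_convex Fyd lcc t01).
rewrite -(pmulr_rge0 _ t0) => mid; move: mid; rewrite {}cm /G hgV.
have -> : dot (t *: y + (1 - t) *: l - z) (t *: y + (1 - t) *: l - z) =
  dot (l - z) (l - z) + 2 * t * dot (y - l) (l - z) +
  t * t * dot (y - l) (y - l).
  by rewrite !dotE (dotC _ y l) (dotC _ z l) (dotC _ z y); ring.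
have -> : dot (y - l) ((2 * h) *: (z - l)) = - (2 * h * dot (y - l) (l - z)).
  by rewrite !dotE; ring.
move: (dot _ _) (dot (y - l) _) (dot (y - l) _) => ? ? ?; nra.
Unshelve. all: by end_near. Qed.

End supremum_of_affine.

(** * Strongly monotone inclusions *)

Section monotone_inclusion.
Context {R : realType} {V : lmodType R} (dot : {dot V for idfun}).
Hypothesis Vc : dot_complete dot.
Implicit Types (u v w x y z : V) (q t : R).

(** Two almost fixed points of a contraction are close to each other.  Applied
    to iterates, this yields the Cauchy property without summing a geometric
    series. *)
Lemma contraction_displacement (K : V -> V) q x y : 0 <= q < 1 ->
  dot (K x - K y) (K x - K y) <= q * dot (x - y) (x - y) ->
  (1 - q) ^+ 2 * dot (x - y) (x - y) <=
    8 * dot (K x - x) (K x - x) + 8 * dot (K y - y) (K y - y).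
Proof.
move=> /andP[q0 q1].
have dE : K x - x + (y - K y) = (K x - K y) - (x - y).
  by rewrite opprB addrACA [RHS]addrACA (addrC (- x)) [- K y + _]addrC.
have := dot_sqrD_le dot (K x - x) (y - K y); rewrite dE -(opprB (K y) y).
move: (x - y) (K x - K y) (K x - x) (K y - y) => w w' a b.
(* Any weight strictly between [q] and [1] would give a constant; the mean
   makes it rational in [q], unlike the optimal weight [sqrt q]. *)
have := dot_ge0 dot (((1 + q) / 2) *: w - w').
rewrite !dotE !opprK (dotC _ w' w).
have := dot_ge0 dot a; have := dot_ge0 dot b.
move: (dot w w) (dot w' w') (dot w w') (dot a a) (dot b b) => W W' P a2 b2.
move=> b0 a0 tw ab Kq.
have h1 : 0 <= (1 - q) * (q * W - W') by apply: mulr_ge0; lra.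
have h2 : 0 <= (1 - q) * (a2 + b2) by apply: mulr_ge0; lra.
have h3 : 0 <= (1 + q) * (2 * a2 + 2 * b2 - (W - 2 * P + W')).
  by apply: mulr_ge0; lra.
lra.
Qed.

(** Banach's fixed point theorem for the distance of [dot]; [q] is the square
    of the Lipschitz constant. *)
Lemma contraction_fixpoint (K : V -> V) q : 0 <= q < 1 ->
  (forall x y, dot (K x - K y) (K x - K y) <= q * dot (x - y) (x - y)) ->
  exists x, K x = x.
Proof.
move=> q01 Kq; have /andP[q0 q1] := q01.
pose u n := iter n K 0; pose c := dot (K 0 - 0) (K 0 - 0).
have step n : dot (K (u n) - u n) (K (u n) - u n) <= c * q ^+ n.
  elim: n => [|n IH]; first by rewrite expr0 mulr1.
  by rewrite exprS mulrCA (le_trans (Kq _ _))// ler_wpM2l.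
have q2 : 0 < (1 - q) ^+ 2 by rewrite exprn_gt0// subr_gt0.
have [l ul] : exists l, dot_cvg dot u l.
  apply: (Vc (e := fun n => (8 * c / (1 - q) ^+ 2) * q ^+ n)).
    rewrite -(mulr0 (8 * c / (1 - q) ^+ 2)); apply: cvgMr; apply: cvg_expr.
    by rewrite ger0_norm.
  move=> n k; have := contraction_displacement q01 (Kq (u n) (u k)).
  have := step n; have := step k.
  move: (dot (u n - _) _) => W sk sn WW.
  have -> : 8 * c / (1 - q) ^+ 2 * q ^+ n + 8 * c / (1 - q) ^+ 2 * q ^+ k =
    (8 * (c * q ^+ n) + 8 * (c * q ^+ k)) / (1 - q) ^+ 2 by ring.
  by rewrite ler_pdivlMr// mulrC (le_trans WW)// lerD// ler_pM2l.
exists l; apply/eqP; rewrite -subr_eq0; apply/eqP/(@dot_eq0 _ _ dot)/eqP.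
rewrite eq_le dot_ge0 andbT.
have s0 : (2 * (q * dot (u n - l) (u n - l)) +
    2 * dot (u n.+1 - l) (u n.+1 - l)) @[n --> \oo] --> (0 : R).
  rewrite [X in _ --> X](_ : 0 = 2 * (q * 0) + 2 * 0); last by ring.
  apply: cvgD; first by apply: cvgMr; exact: cvgMr.
  by apply: cvgMr; rewrite (cvg_shiftS (fun n => dot (u n - l) (u n - l))).
apply: (cvgr_to_ge s0); near=> n.
have := dot_sqrD_le dot (K l - K (u n)) (K (u n) - l).
rewrite addrA subrK => /le_trans; apply; rewrite lerD2r ler_pM2l//.
by rewrite (le_trans (Kq _ _))// -(opprB (u n)) dotNl dotNr opprK.
Unshelve. all: by end_near. Qed.

Context {F : V -> \bar R} {A : set (V * R)}.
Hypotheses (FA : affine_sup dot A F) (A0 : A !=set0) (F0 : edom F !=set0).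

(** For the differences [p] and [z] of outputs and inputs, monotonicity of the
    subdifferential gives [|p|^2 <= <z, p>]; conclude with [0 <= |z - p|^2]. *)
Lemma prox_nonexpansive g z z' p p' : 0 < g ->
  subdiff dot F p (g^-1 *: (z - p)) -> subdiff dot F p' (g^-1 *: (z' - p')) ->
  dot (p - p') (p - p') <= dot (z - z') (z - z').
Proof.
move=> g0 zp zp'; have := subdiff_monotone FA A0 F0 zp zp'.
rewrite -scalerBr dotZl pmulr_rge0 ?invr_gt0//.
have -> : z - p - (z' - p') = (z - z') - (p - p').
  by rewrite !opprB addrACA [RHS]addrACA [- p + _]addrC.
move: (p - p') (z - z') => {zp zp'}p {}z zp.
have := dot_ge0 dot (z - p); move: zp; rewrite !dotE (dotC _ p z); lra.
Qed.

(** [- B y] is a subgradient at [y] iff [y] is a fixed point of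
    [y |-> J (y - g B y)], where [J] is the proximal map of parameter [g].
    Uniqueness combines monotonicity of the subdifferential with strong
    monotonicity of [B]. *)
Theorem strongly_monotone_inclusion (B : V -> V) (mu L : R) : 0 < mu ->
  (forall x y, mu * dot (x - y) (x - y) <= dot (B x - B y) (x - y)) ->
  (forall x y, dot (B x - B y) (B x - B y) <= L * dot (x - y) (x - y)) ->
  exists! y, subdiff dot F y (- B y).
Proof.
move=> mu0 Bmu BL.
(* Enlarging [L] beyond [mu ^+ 2] makes [M] positive and the contraction
   factor nonnegative, also when [V] is trivial and [L <= 0]. *)
pose M := Num.max L (mu ^+ 2).
have mu2 : 0 < mu ^+ 2 by rewrite exprn_gt0.
have M0 : 0 < M by rewrite lt_max mu2 orbT.
have BM x y : dot (B x - B y) (B x - B y) <= M * dot (x - y) (x - y).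
  by rewrite (le_trans (BL _ _))// ler_wpM2r ?dot_ge0// le_max lexx.
(* The step minimizing the factor [1 - 2 g mu + g^2 M] of [Id - g B]. *)
pose g := mu / M.
have g0 : 0 < g by rewrite divr_gt0.
have [J JP] := choice (fun z => prox_exists FA A0 Vc z F0 g0).
have [y Jy] : exists y, J (y - g *: B y) = y.
  apply: (contraction_fixpoint (q := 1 - mu ^+ 2 / M)).
    rewrite subr_ge0 ltrBlDr ltrDl ler_pdivrMr// mul1r divr_gt0// andbT.
    by rewrite le_max lexx orbT.
  move=> x y; apply: le_trans (prox_nonexpansive g0 (JP _) (JP _)) _.
  have -> : x - g *: B x - (y - g *: B y) = (x - y) - g *: (B x - B y).
    by rewrite scalerBr !opprB addrACA [RHS]addrACA [- (g *: B x) + _]addrC.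
  have := Bmu x y; have := BM x y.
  move: (x - y) (B x - B y) => w b bM bmu; rewrite !dotE (dotC _ w b).
  have gmu : mu ^+ 2 / M = mu * g by rewrite /g expr2 mulrA.
  have gM : g * M = mu by rewrite /g divfK// gt_eqF.
  have : g * (g * dot b b) <= mu * g * dot w w.
    rewrite -{1}gM [leRHS](_ : _ = g * (g * (M * dot w w))); last by ring.
    by rewrite !ler_pM2l.
  have : g * (mu * dot w w) <= g * dot b w by rewrite ler_pM2l.
  rewrite gmu; lra.
have Fy : subdiff dot F y (- B y).
  have := JP (y - g *: B y); rewrite Jy addrAC subrr add0r -scalerN scalerA.
  by rewrite mulVf ?scale1r// gt_eqF.
exists y; split=> // x Fx.
apply/eqP; rewrite -subr_eq0; apply/eqP/(@dot_eq0 _ _ dot)/eqP.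
rewrite eq_le dot_ge0 andbT -(pmulr_rle0 _ mu0) (le_trans (Bmu _ _))//.
have := subdiff_monotone FA A0 F0 Fx Fy.
by rewrite opprK addrC -(opprB y x) dotNr oppr_ge0.
Qed.

End monotone_inclusion.

(** * The sum of a conjugate and the support function of a subspace *)

Section conjugate_plus_support.
Context {R : realType} {V : lmodType R} (dot : {dot V for idfun}).
Implicit Types (u v x y z d : V) (c r t : R).

Lemma fenchel_conj_leP (f : V -> \bar R) y (b : \bar R) :
  (fenchel_conj dot f y <= b)%E <->
  forall x, ((dot x y)%:E - f x <= b)%E.
Proof.
split=> [fb x|fb]; last by apply: ge_ereal_sup => _ [x _ <-].
by apply: le_trans fb; apply: ereal_sup_ubound; exists x.
Qed.

Lemma fenchel_conj_ge (f : V -> \bar R) x y r : (f x <= r%:E)%E ->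
  ((dot x y - r)%:E <= fenchel_conj dot f y)%E.
Proof.
move=> fxr; apply: le_trans (_ : ((dot x y)%:E - f x <= _)%E).
  by rewrite EFinD leeD2l// EFinN leeN2.
by apply: ereal_sup_ubound; exists x.
Qed.

Context {C : set V} {f : V -> \bar R}.
Hypotheses (C0 : C 0) (CZ : forall t d, C d -> C (t *: d)).
Hypotheses (fNy : forall x, f x != -oo%E) (f0 : edom f !=set0).

Local Notation F :=
  (fun y => (fenchel_conj dot f y + fenchel_conj dot (cvx_indicator C) y)%E).

Lemma conj_indicator_ge d y : C d ->
  ((dot d y)%:E <= fenchel_conj dot (cvx_indicator C) y)%E.
Proof.
move=> Cd; rewrite -[dot d y]subr0; apply: fenchel_conj_ge.
by rewrite /cvx_indicator mem_set.
Qed.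

Lemma conj_indicator_le0 y : orth_compl dot C y ->
  (fenchel_conj dot (cvx_indicator C) y <= 0)%E.
Proof.
move=> Cy; apply/fenchel_conj_leP => d; rewrite /cvx_indicator.
case: ifPn => [/set_mem /Cy ->|_]; last by rewrite addeNy leNye.
by rewrite sube0.
Qed.

(** The affine minorants [<x + d, .> - r] of the sum: add a minorant
    [<x, .> - r] of the conjugate of [f] to a minorant [<d, .>] of the support
    function of [C]. *)
Definition conj_support_family : set (V * R) :=
  [set p | exists x d r, [/\ C d, (f x <= r%:E)%E & p = (x + d, r)]].

Lemma edom_fin x : edom f x -> exists r, f x = r%:E.
Proof.
by rewrite /edom/=; have := fNy x; case: (f x) => // r _ _; exists r.
Qed.

Lemma conj_support_family_neq0 : conj_support_family !=set0.
Proof.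
case: f0 => x /edom_fin[r fx].
by exists (x + 0, r), x, 0, r; rewrite fx; split.
Qed.

(** If the functions of the family are bounded by [c] at [y], then so is
    [<x, y> + t <d, y> - r] for all [t], which forces [y] to be orthogonal to
    [C]; there the support function vanishes. *)
Lemma conj_support_affine_sup : affine_sup dot conj_support_family F.
Proof.
move=> y c; split=> [Fc _ [x [d [r [Cd fx ->]]]]/=|Ac].
  rewrite -lee_fin; apply: le_trans Fc.
  rewrite dotDl addrAC EFinD; apply: leeD; first exact: fenchel_conj_ge.
  exact: conj_indicator_ge.
have [x0 /edom_fin[r0 fx0]] := f0.
have Cy : orth_compl dot C y.
  move=> d Cd; apply/eqP; apply/negPn/negP => dy0.
  (* Chosen so that the affine function takes the value [c + 1] at [y]. *)
  pose t := (c - (dot x0 y - r0) + 1) / dot d y.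
  have : conj_support_family (x0 + t *: d, r0).
    by exists x0, (t *: d), r0; split; [exact: CZ|rewrite fx0|].
  move/Ac; rewrite /= !dotE /t divfK//; lra.
rewrite -[leRHS]adde0; apply: leeD; last exact: conj_indicator_le0.
apply/fenchel_conj_leP => x; have := fNy x.
case fx : (f x) => [r||]// _; last by rewrite addeNy leNye.
rewrite -EFinB lee_fin -[x]addr0; apply: (Ac (x + 0, r)).
by exists x, 0, r; rewrite fx.
Qed.

Lemma conj_support_edom :
  edom (fenchel_conj dot f) `&` orth_compl dot C !=set0 -> edom F !=set0.
Proof.
case=> y [fy Cy]; exists y; rewrite /edom/=; apply: lte_add_pinfty => //.
by rewrite (le_lt_trans (conj_indicator_le0 Cy))// ltry.
Qed.

(** As [y] is a subgradient of [f] at [x], the supremum defining the conjugate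
    at [y] is attained at [x], so the minorant [<x + d, .> - f x] of the sum is
    exact at [y]. *)
Lemma subdiff_conj_support x y d : subdiff dot f x y ->
  orth_compl dot C y -> C d -> subdiff dot F y (x + d).
Proof.
move=> xy Cy Cd.
have [r fx] := edom_fin (subdiff_edom f0 xy).
have Fy : (F y <= (dot x y - r)%:E)%E.
  rewrite -[leRHS]adde0; apply: leeD; last exact: conj_indicator_le0.
  apply/fenchel_conj_leP => z; have := xy z; have := fNy z; rewrite fx.
  case: (f z) => [s||]// _; last by rewrite addeNy leNye.
  rewrite -EFinB -EFinD !lee_fin !dotE; lra.
have [c Fyc] := affine_sup_fin conj_support_affine_sup
  conj_support_family_neq0 (le_lt_trans Fy (ltry _)).
apply/(subdiff_epiP conj_support_affine_sup conj_support_family_neq0 _ Fyc).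
move=> z b /conj_support_affine_sup Fz.
have /Fz/= : conj_support_family (x + d, r) by exists x, d, r; rewrite fx.
move: Fy; rewrite Fyc lee_fin !dotE.
rewrite (dotC _ y d) (Cy _ Cd) (dotC _ x y) (dotC _ x z) (dotC _ d z); lra.
Qed.

End conjugate_plus_support.

(** * The product Hilbert space *)

Section product_inner_product.
Context {R : realType} {X : lmodType R} {m : nat} (dot : {dot X for idfun}).
Implicit Types (x y z : 'I_m -> X).

Lemma prod_dot_bilinear :
  bilinear_for (GRing.Scale.Law.clone _ _ *%R _)
    (GRing.Scale.Law.clone _ _ (idfun \; *%R) _) (@prod_dot R X m dot).
Proof.
split=> [z|z] a x y /=; rewrite /prod_dot mulr_sumr -big_split/=;
  apply: eq_bigr => i _; by rewrite ?linearPl ?linearPr.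
Qed.

Lemma prod_dot_sym x y :
  prod_dot dot x y = (-1) ^+ false * idfun (prod_dot dot y x).
Proof.
by rewrite expr0 mul1r; apply: eq_bigr => i _; exact: dotC.
Qed.

Lemma prod_dot_posdef x : x != 0 -> 0 < prod_dot dot x x.
Proof.
move=> x0; rewrite lt_neqAle sumr_ge0 ?andbT; last first.
  by move=> i _; exact: dot_ge0.
apply: contra x0 => /eqP x0; apply/eqP/funext => i; apply: (@dot_eq0 _ _ dot).
have /psumr_eq0P : prod_dot dot x x = 0 by [].
by apply => // j _; exact: dot_ge0.
Qed.

HB.instance Definition _ := bilinear_isBilinear.Build R ('I_m -> X) ('I_m -> X)
  R _ _ (@prod_dot R X m dot) prod_dot_bilinear.
HB.instance Definition _ := isHermitianSesquilinear.Build R ('I_m -> X)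
  false idfun (@prod_dot R X m dot) prod_dot_sym.
HB.instance Definition _ := isDotProduct.Build R ('I_m -> X)
  (@prod_dot R X m dot) prod_dot_posdef.

(** This fact and the next two are bilinearity with [prod_dot] itself as head
    symbol, which makes them usable as rewrite rules. *)
Lemma prod_dotZl a x y :
  prod_dot dot (a *: x) y = a * prod_dot dot x y.
Proof. exact: (dotZl (@prod_dot R X m dot)). Qed.

Lemma prod_dotZr a x y :
  prod_dot dot x (a *: y) = a * prod_dot dot x y.
Proof. exact: (dotZr (@prod_dot R X m dot)). Qed.

Lemma prod_dot_suml (I : Type) (r : seq I) (x : I -> 'I_m -> X) y :
  prod_dot dot (\sum_(k <- r) x k) y = \sum_(k <- r) prod_dot dot (x k) y.
Proof. exact: (linear_sumlz (@prod_dot R X m dot)). Qed.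

End product_inner_product.

Section product_complete.
Context {R : realType} {X : completeNormedModType R} {m : nat}.
Context (dot : {dot X for idfun}).
Hypothesis hdot : induces_norm dot.

Lemma norm_dot_complete : dot_complete dot.
Proof.
move=> u e e0 ue.
have /cauchy_cvgP/cvg_ex[l ul] : cauchy (u @ \oo).
  apply: cauchy_exP => _/posnumP[r].
  have r2 : 0 < r%:num ^+ 2 / 2 by rewrite divr_gt0.
  have [N _ eN] := cvgr_lt _ e0 _ r2.
  exists (u N); exists N => // n Nn /=; rewrite -ball_normE/=.
  rewrite -(ltr_pXn2r (n := 2))// ?nnegrE//.
  rewrite -hdot (le_lt_trans (ue _ _))//.
  by have := eN n Nn; have := eN N (leqnn N); rewrite /=; lra.
exists l; rewrite /dot_cvg.
have n0 : `|u n - l| @[n --> \oo] --> (0 : R).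
  by apply/norm_cvg0P/subr_cvg0.
rewrite [X in _ --> X](_ : 0 = 0 * 0); last by rewrite mulr0.
under eq_fun do rewrite hdot expr2.
exact: cvgM.
Qed.

Lemma prod_dot_complete : dot_complete (@prod_dot R X m dot).
Proof.
move=> u e e0 ue.
have /choice[l ul] : forall i, exists l, dot_cvg dot (fun n => u n i) l.
  move=> i; apply: (norm_dot_complete e0) => n k; apply: le_trans (ue n k).
  rewrite /= /prod_dot (bigD1 i)//= lerDl sumr_ge0// => j _; exact: dot_ge0.
exists l; rewrite /dot_cvg /= /prod_dot.
rewrite [X in _ --> X](_ : 0 = \sum_(i < m) 0); last by rewrite big1.
by apply: cvg_big => [|i _]; [exact: add_continuous|exact: ul].
Qed.

End product_complete.

(** * The cyclic shift and the operator T *)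

Section cyclic_shift_algebra.
Context {R : realType} {X : lmodType R} {m : nat} (dot : {dot X for idfun}).
Implicit Types (x y w : 'I_m -> X) (k n : nat).

Local Notation S := (@cyclic_shift R X m).
Local Notation pdot := (@prod_dot R X m dot).
Local Notation pdotT := (pdot : {dot ('I_m -> X) for idfun}).

Lemma iter_shiftE k x i : iter k S x i = x (iter k (@ord_pred m) i).
Proof.
elim: k i => //= k IH i.
by rewrite /cyclic_shift IH -iterSr.
Qed.

(** Positions are computed on [ordS], whose value is a plain sum modulo [m];
    [ord_pred] is its inverse. *)
Lemma iter_shift_period x : iter m S x = x.
Proof.
have ordSn n (i : 'I_m) : val (iter n (@ordS m) i) = ((i + n) %% m)%N.
  elim: n => [|n IH] /=; first by rewrite addn0 modn_small.
  by rewrite IH -addn1 modnDml addn1 addnS.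
apply/funext => i; rewrite iter_shiftE; congr (x _).
have ordSm : iter m (@ordS m) i = i.
  by apply: val_inj; rewrite ordSn modnDr modn_small.
have predK n : iter n (@ord_pred m) (iter n (@ordS m) i) = i.
  by elim: n => // n IH; rewrite iterSr iterS ordSK.
by rewrite -{1}ordSm predK.
Qed.

Lemma iter_shiftB k x y : iter k S (x - y) = iter k S x - iter k S y.
Proof. by apply/funext => i; rewrite !(iter_shiftE, fctE). Qed.

Lemma iter_shift_isometry k x y : pdot (iter k S x) (iter k S y) = pdot x y.
Proof.
rewrite /prod_dot [RHS](reindex_inj (h := iter k (@ord_pred m)))/=.
  by apply: eq_bigr => i _; rewrite !iter_shiftE.
by elim: k => //= k IH i j /ord_pred_inj/IH.
Qed.

Lemma shift_invariant_diagonal x : S x = x -> diagonal_space x.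
Proof.
move=> Sx; case: m x Sx => [|m'] x Sx.
  by exists 0; apply/funext => -[].
exists (x ord0); apply/funext => -[i im].
elim: i im => [|i IH] im; first by congr (x _); apply: val_inj.
rewrite -(IH (ltnW im)) -[in LHS]Sx /cyclic_shift; congr (x _).
by apply: val_inj; rewrite /= modnDr modn_small// ltnW.
Qed.

(** Shifting permutes the summands cyclically. *)
Lemma shift_orbit_sum_diagonal w : diagonal_space (\sum_(k < m) iter k S w).
Proof.
apply: shift_invariant_diagonal.
have -> : S (\sum_(k < m) iter k S w) = \sum_(k < m) iter k.+1 S w.
  by apply/funext => i; rewrite /cyclic_shift !fct_sumE.
apply: (addrI w).
rewrite -[in LHS](big_ord_recl m (fun k : 'I_m.+1 => iter k S w)).
by rewrite big_ord_recr/= iter_shift_period addrC.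
Qed.

Lemma skewTB x y : skewT (x - y) = skewT x - skewT y.
Proof.
rewrite /skewT -scalerBr; congr (_ *: _); rewrite -sumrB.
by apply: eq_bigr => k _; rewrite iter_shiftB scalerBr.
Qed.

(** [<R^k x, x>] is invariant under [k |-> m - k], while the coefficient
    [m - 2 k] changes sign. *)
Lemma skewT_skew x : pdot (skewT x) x = 0.
Proof.
pose a k := pdot (iter k S x) x.
have aC k : (k <= m)%N -> a (m - k)%N = a k.
  move=> km; rewrite /a -(iter_shift_isometry k) -iterD subnKC//.
  by rewrite iter_shift_period (dotC pdotT).
pose s := \sum_(1 <= k < m) (m%:R - 2 * k%:R) * a k.
have -> : pdot (skewT x) x = (2 * m%:R)^-1 * s.
  rewrite /skewT prod_dotZl prod_dot_suml; congr (_ * _).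
  by apply: eq_bigr => k _; rewrite prod_dotZl.
suff -> : s = 0 by rewrite mulr0.
suff : s = - s by lra.
rewrite {1}/s big_nat_rev/= -sumrN; apply: eq_big_nat => k /andP[k1 km].
rewrite add1n subSS aC ?(ltnW km)// natrB ?(ltnW km)//; ring.
Qed.

(** A finite combination of isometries; the constant is built by induction on
    the list of exponents. *)
Lemma skewT_bounded : exists L, forall x,
  pdot (skewT x) (skewT x) <= L * pdot x x.
Proof.
have [L sL] : exists L, forall x,
    pdot (\sum_(1 <= k < m) (m%:R - 2 * k%:R : R) *: iter k S x)
      (\sum_(1 <= k < m) (m%:R - 2 * k%:R : R) *: iter k S x) <= L * pdot x x.
  elim: (index_iota 1 m) => [|k s [L sL]].
    by exists 0 => x; rewrite big_nil (dot0l pdotT) mul0r.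
  exists (2 * (m%:R - 2 * k%:R) ^+ 2 + 2 * L) => x; rewrite big_cons.
  apply: (le_trans (dot_sqrD_le pdotT _ _)).
  rewrite /= prod_dotZl prod_dotZr iter_shift_isometry mulrDl.
  by have := sL x; lra.
exists ((2 * m%:R)^-1 ^+ 2 * L) => x.
rewrite /skewT prod_dotZl prod_dotZr mulrA -expr2 -(mulrA _ L).
by rewrite ler_wpM2l ?sqr_ge0.
Qed.

(** Summation by parts for coefficients in arithmetic progression. *)
Lemma telescope_skew (V : lmodType R) (u : nat -> V) (c : R) n : (0 < n)%N ->
  \sum_(1 <= k < n) (c - 2 * k%:R) *: (u k - u k.+1) =
  c *: u 1%N - 2 *: \sum_(1 <= k < n) u k - (c - 2 * n%:R + 2) *: u n.
Proof.
elim: n => // -[|n] IH _.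
  by rewrite !big_geq// scaler0 subr0 mulr1 subrK subrr.
rewrite big_nat_recr//= IH// [in RHS]big_nat_recr//=.
set s := \sum_(_ <= _ < _) _; set b := u n.+1; set d := u n.+2.
have -> : c - 2 * n.+2%:R + 2 = c - 2 * n.+1%:R.
  by rewrite -[in n.+2%:R]natr1; ring.
move: (c - _) => e; rewrite scalerBr scalerDr (scalerDl b e 2) !opprD !addrA.
by congr (_ - _); rewrite addrAC subrK.
Qed.

(** On the range of [Id - R], the operator [Id / 2 + T] is a selection of the
    set-valued inverse [(Id - R)^-1]: it recovers [w] up to its projection on
    the diagonal. *)
Lemma skewT_subr_shift w : (0 < m)%N ->
  2^-1 *: (w - S w) + skewT (w - S w) = w - m%:R^-1 *: \sum_(k < m) iter k S w.
Proof.
move=> m0.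
have mR : (m%:R : R) != 0 by rewrite pnatr_eq0 -lt0n.
pose u k := iter k S w.
have -> : skewT (w - S w) = (2 * m%:R)^-1 *: (m%:R *: u 1%N + m%:R *: w -
    2 *: \sum_(k < m) u k).
  rewrite /skewT; congr (_ *: _).
  transitivity (\sum_(1 <= k < m) (m%:R - 2 * k%:R : R) *: (u k - u k.+1)).
    by apply: eq_bigr => k _; rewrite iter_shiftB /u iterSr.
  rewrite telescope_skew// {3}/u iter_shift_period.
  rewrite -(big_mkord xpredT u) big_ltn// scalerDr.
  have -> : m%:R - 2 * m%:R + 2 = 2 - m%:R :> R by ring.
  rewrite scalerBl opprB opprD -!addrA; congr (_ + _).
  by rewrite addrCA; congr (_ + _); rewrite addrC.
rewrite !(scalerBr, scalerDr) !scalerA.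
have -> : (2 * m%:R)^-1 * m%:R = 2^-1 :> R by field.
have -> : (2 * m%:R)^-1 * 2 = m%:R^-1 :> R by field.
rewrite addrA; congr (_ - _).
by rewrite addrA addrNK -scalerDl (_ : _ + _ = 1) ?scale1r//; field.
Qed.

(** By skewness, only [Id / 2] contributes. *)
Lemma half_skewT_strongly_monotone x y :
  2^-1 * pdot (x - y) (x - y) <=
  pdot (2^-1 *: x + skewT x - (2^-1 *: y + skewT y)) (x - y).
Proof.
rewrite opprD addrACA -scalerBr -skewTB (dotDl pdotT (2^-1 *: (x - y))) /=.
by rewrite prod_dotZl skewT_skew addr0.
Qed.

Lemma half_skewT_lipschitz : exists L, forall x y,
  pdot (2^-1 *: x + skewT x - (2^-1 *: y + skewT y))
       (2^-1 *: x + skewT x - (2^-1 *: y + skewT y)) <=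
  L * pdot (x - y) (x - y).
Proof.
have [L TL] := skewT_bounded.
exists (2 * 2^-1 ^+ 2 + 2 * L) => x y.
rewrite opprD addrACA -scalerBr -skewTB.
apply: (le_trans (dot_sqrD_le pdotT _ _)); rewrite /= prod_dotZl prod_dotZr.
by have := TL (x - y); lra.
Qed.

End cyclic_shift_algebra.

(** * The two dual problems *)

Section dual_problem_bridge.
Context {R : realType} {X : completeNormedModType R} {m : nat}.
Context (dot : {dot X for idfun}) (f : 'I_m -> X -> \bar R).

Local Notation S := (@cyclic_shift R X m).
Local Notation pdot := (@prod_dot R X m dot).
Local Notation pdotT := (pdot : {dot ('I_m -> X) for idfun}).
Local Notation F := (fun z => fenchel_conj pdot (sep_sum f) z +
  fenchel_conj pdot (cvx_indicator diagonal_space) z)%E.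

Lemma sep_sum_proper : (forall i, ereal_proper (f i)) ->
  ereal_proper (sep_sum f).
Proof.
move=> fp; split=> [x|].
  rewrite /sep_sum esum_eqNy; apply/existsP => -[i /=].
  by apply/negP; exact: (fp i).1.
have /choice[x fx] := fun i => (fp i).2.
by exists x; rewrite /edom/=; apply: lte_sum_pinfty => i _; exact: fx.
Qed.

Lemma diagonal_space0 : diagonal_space (0 : 'I_m -> X).
Proof. by exists 0. Qed.

Lemma diagonal_spaceZ t (d : 'I_m -> X) :
  diagonal_space d -> diagonal_space (t *: d).
Proof. by case=> z ->; exists (t *: z). Qed.

(** Constant tuples are fixed by the shift, which is an isometry. *)
Lemma shift_displacement_orthogonal w :
  orth_compl pdot diagonal_space (w - S w).
Proof.
move=> _ [z ->]; rewrite (linearBr pdotT); apply/eqP; rewrite subr_eq0.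
by apply/eqP; exact: (esym (iter_shift_isometry dot 1 (fun=> z) w)).
Qed.

Lemma enlarged_dual_solutionsE y : enlarged_dual_solutions dot f y <->
  subdiff pdot F y (- (2^-1 *: y + skewT y)).
Proof.
split=> [[_ [u uF [_ -> <-]] [_ -> uy]]|yF].
  suff <- : u = - (2^-1 *: y + skewT y) by [].
  by apply/eqP; rewrite -addr_eq0 addrA uy.
exists (- (2^-1 *: y + skewT y) + 2^-1 *: y).
  by exists (- (2^-1 *: y + skewT y)) => //; exists (2^-1 *: y).
by exists (skewT y) => //; rewrite -addrA addNr.
Qed.

Lemma dual_solution_enlarged y : (0 < m)%N -> ereal_proper (sep_sum f) ->
  dual_solutions dot f y -> enlarged_dual_solutions dot f y.
Proof.
move=> m0 [fNy f0] [x xy [w yw xw]]; apply/enlarged_dual_solutionsE.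
rewrite /inv_op /graph_op /= in xy yw.
have -> : - (2^-1 *: y + skewT y) = x + m%:R^-1 *: \sum_(k < m) iter k S w.
  rewrite yw skewT_subr_shift// opprB addrC.
  by move/addr0_eq : xw => <-; rewrite opprK.
apply: (subdiff_conj_support (dot := pdotT) diagonal_space0 _ fNy f0 xy).
- by move=> t d; exact: diagonal_spaceZ.
- by rewrite yw; exact: shift_displacement_orthogonal.
- exact/diagonal_spaceZ/shift_orbit_sum_diagonal.
Qed.

End dual_problem_bridge.

(** * Existence, uniqueness and comparison of the solutions *)

Theorem proposition4p1 (R : realType) (X : completeNormedModType R)
    (dot : {dot X for idfun}) (hdot : induces_norm dot)
    (m : nat) (hm : (0 < m)%N)
    (f : 'I_m -> X -> \bar R)
    (hproper : forall i, ereal_proper (f i))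
    (hlsc : forall i, lower_semicontinuous (f i))
    (hconvex : forall i, ereal_convex (f i))
    (hdom : edom (fenchel_conj (prod_dot dot) (sep_sum f)) `&`
            orth_compl (prod_dot dot) diagonal_space !=set0) :
  (exists! y : 'I_m -> X, enlarged_dual_solutions dot f y) /\
  (dual_solutions dot f !=set0 ->
     dual_solutions dot f = enlarged_dual_solutions dot f).
Proof.
have fp := sep_sum_proper hproper; have [fNy f0] := fp.
pose pdot : {dot ('I_m -> X) for idfun} := @prod_dot R X m dot.
have sol : exists! y, enlarged_dual_solutions dot f y.
  have [L BL] := @half_skewT_lipschitz R X m dot.
  have [y [yF yU]] := strongly_monotone_inclusion (prod_dot_complete hdot)
    (conj_support_affine_sup pdot diagonal_space0 (@diagonal_spaceZ _ _ _)
      fNy f0)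
    (conj_support_family_neq0 diagonal_space0 fNy f0) (conj_support_edom hdom)
    (mu := 2^-1) ltac:(lra) (half_skewT_strongly_monotone dot) BL.
  exists y; split; first exact/enlarged_dual_solutionsE.
  by move=> z /enlarged_dual_solutionsE; exact: yU.
split=> // -[x xD]; have [y [yE yU]] := sol.
have Dy z : dual_solutions dot f z -> y = z.
  by move=> /(dual_solution_enlarged hm fp); exact: yU.
apply/seteqP; split=> z; first exact: dual_solution_enlarged.
by move=> /yU <-; rewrite (Dy x xD).
Qed.
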